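(* For every positive integer $m$ and every $\epsilon > 0$ there exist $M = M(\epsilon,m)$ and $N = N(\epsilon,m)$ such that, for every $n \geq N$, every permutation $\sigma : \mathbb{Z}_n \rightarrow \mathbb{Z}_n$ has an $\epsilon$-regular partition into $k$ (nonexceptional) intervals for some $k$ with $m \leq k \leq M$.
   Context: $\mathbb{Z}_n$ is identified with $\{0,1,\ldots,n-1\}$ with its usual linear order; an interval of $\mathbb{Z}_n$ is a set of consecutive integers in it. Fix a permutation $\sigma$ of $\mathbb{Z}_n$. For nonempty $S,T \subset \mathbb{Z}_n$ let $p(S,T) = |\{(s,t)\in S\times T : \sigma(s) < t\}|$ and $d(S,T) = p(S,T)/(|S||T|)$. A partition of $\sigma$ into $k$ parts means a partition $\{C_j\}_{j=0}^k$ of $\mathbb{Z}_n$ with a designated exceptional set $C_0$ (possibly empty, not necessarily an interval) and in which each $C_j$, $1\le j\le k$, is a nonempty interval. A pair $(C_s,C_t)$ (with $1 \le s,t\le k$) is $\epsilon$-regular if for all intervals $I \subset C_s$, $J \subset C_t$ with $|I| \geq \epsilon|C_s|$ and $|J|\geq \epsilon|C_t|$ we have $|d(I,J)-d(C_s,C_t)| \leq \epsilon$. The partition $\{C_j\}_{j=0}^k$ is an $\epsilon$-regular partition into $k$ parts if (i) $|C_s|=|C_t|$ for all $1\leq s,t\leq k$; (ii) $|C_0|\leq \epsilon n$; (iii) $(C_s,C_t)$ is $\epsilon$-regular for all but at most $\epsilon k^2$ of the ordered pairs $(s,t)\in\{1,\ldots,k\}^2$. *)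

(* Defs.v *)
From HB Require Import structures.
From mathcomp Require Import all_boot all_order all_algebra all_fingroup.
From mathcomp Require Import boolp reals.

Set Implicit Arguments.
Unset Strict Implicit.
Unset Printing Implicit Defensive.

Import Order.TTheory GRing.Theory Num.Theory.
Local Open Scope ring_scope.

(* Z_n is only used as the ordered set {0, ..., n-1}, hence ['I_n] rather than
   the ring type ['Z_n] (which is not Z_n for n < 2). *)

(* The empty set qualifies (a = b); nonemptiness is required separately. *)
Definition is_interval (n : nat) (S : {set 'I_n}) : Prop :=
  exists a b : nat, S = [set i : 'I_n | (a <= i < b)%N].

Definition pcount (n : nat) (sigma : {perm 'I_n}) (S T : {set 'I_n}) : nat :=
  #|[set st in setX S T | (sigma st.1 < st.2)%N]|.

(* Meaningful for nonempty S and T; it is 0 otherwise. *)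
Definition density (R : realType) (n : nat) (sigma : {perm 'I_n})
    (S T : {set 'I_n}) : R :=
  (pcount sigma S T)%:R / (#|S|%:R * #|T|%:R).

(* For eps > 0 and nonempty A and B, the size conditions force I and J to be
   nonempty. *)
Definition regular_pair (R : realType) (n : nat) (sigma : {perm 'I_n})
    (eps : R) (A B : {set 'I_n}) : Prop :=
  forall I J : {set 'I_n},
    is_interval I -> is_interval J -> I \subset A -> J \subset B ->
    eps * #|A|%:R <= #|I|%:R -> eps * #|B|%:R <= #|J|%:R ->
    `|density R sigma I J - density R sigma A B| <= eps.

(* [C ord0] is the exceptional set C_0; the nonexceptional parts C_1, ..., C_k
   are the [C (lift ord0 j)] with [j : 'I_k]. *)
Definition is_interval_partition (n k : nat) (C : 'I_k.+1 -> {set 'I_n}) :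
    Prop :=
  [/\ \bigcup_(j < k.+1) C j = [set: 'I_n],
      forall i j : 'I_k.+1, i != j -> [disjoint C i & C j]
    & forall j : 'I_k,
        C (lift ord0 j) != set0 /\ is_interval (C (lift ord0 j))].

Definition irregular_pairs (R : realType) (n : nat) (sigma : {perm 'I_n})
    (eps : R) (k : nat) (C : 'I_k.+1 -> {set 'I_n}) : {set 'I_k * 'I_k} :=
  [set st : 'I_k * 'I_k |
    ~~ `[< regular_pair sigma eps (C (lift ord0 st.1)) (C (lift ord0 st.2)) >]].

Definition regular_partition (R : realType) (n : nat) (sigma : {perm 'I_n})
    (eps : R) (k : nat) (C : 'I_k.+1 -> {set 'I_n}) : Prop :=
  [/\ is_interval_partition C,
      forall s t : 'I_k, #|C (lift ord0 s)| = #|C (lift ord0 t)|,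
      #|C ord0|%:R <= eps * n%:R
    & #|irregular_pairs sigma eps C|%:R <= eps * k%:R ^+ 2].

(* Main.v *)
(* The energy of a partition into k intervals is the average of d(C_s, C_t)^2
   over its pairs.  All partitions considered consist of k = m K^i consecutive
   blocks of equal width, for i = 0, ..., r; each refines the previous one, and
   they share one exceptional set, the fewer than m K^r last elements.  If a pair
   of blocks is irregular, the intervals I, J witnessing it can be replaced by
   unions of sub-blocks, at the cost of the cells meeting their boundaries, once
   K >= 8 / eps^3.  The densities of the cells thus deviate from their mean by
   eps^3 / 2 on average, so a partition with more than eps k^2 irregular pairs
   has energy at least eps (eps^3 / 2)^2 below that of the next one.  Energies
   lie in [0, 1], so some i <= r gives a regular partition. *)
Require Import Defs.
From HB Require Import structures.
From mathcomp Require Import all_boot all_order all_algebra all_fingroup.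
From mathcomp Require Import boolp reals.
From mathcomp Require Import ring lra.

Set Implicit Arguments.
Unset Strict Implicit.
Unset Printing Implicit Defensive.

Import Order.TTheory GRing.Theory Num.Theory.
Local Open Scope ring_scope.

(** * Blocks of equal width *)

(** Also used on index sets: [block (k * K) K s] holds the indices of the cells, the blocks of width
    [l], that make up the block [s] of width [l * K]. *)
Definition block (n w s : nat) : {set 'I_n} := [set i : 'I_n | i %/ w == s]%N.

Lemma card_block (n w s : nat) :
  (0 < w)%N -> (s.+1 * w <= n)%N -> #|block n w s| = w.
Proof.
move=> w0 hs.
have lt_n (j : 'I_w) : (s * w + j < n)%N.
  by apply: leq_trans hs; rewrite mulSn addnC ltn_add2r.
have -> : block n w s = [set Ordinal (lt_n j) | j : 'I_w].
  apply/setP=> i; rewrite inE; apply/eqP/imsetP => [is_ | [j _ ->] /=].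
    exists (Ordinal (ltn_pmod i w0)) => //.
    by apply: val_inj; rewrite /= -is_ -divn_eq.
  by rewrite divnMDl // divn_small // addn0.
rewrite card_imset ?card_ord // => i j [] /eqP.
by rewrite eqn_add2l => /eqP /val_inj.
Qed.

Lemma block_interval (n w s : nat) : (0 < w)%N -> is_interval (block n w s).
Proof.
move=> w0; exists (s * w)%N, (s.+1 * w)%N; apply/setP=> i.
by rewrite !inE -leq_divRL // -ltn_divLR // ltnS eqn_leq andbC.
Qed.

Lemma sum_blocks (V : nmodType) (k w : nat) (F : 'I_(k * w) -> V) :
  (0 < w)%N -> \sum_i F i = \sum_(s < k) \sum_(i in block (k * w) w s) F i.
Proof.
move=> w0; have lt_k (i : 'I_(k * w)) : (i %/ w < k)%N by rewrite ltn_divLR.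
rewrite (partition_big (fun i => Ordinal (lt_k i)) xpredT) //=.
by apply: eq_bigr => s _; apply: eq_bigl => i; rewrite inE.
Qed.

(** Rests on [i %/ (l * K) = i %/ l %/ K]: the fibres of [i %/ l] on a wide block are its cells. *)
Lemma sum_subblocks (V : nmodType) (n k l K s : nat) (F : 'I_n -> V) :
  (0 < K)%N -> (s < k)%N ->
  \sum_(i in block n (l * K) s) F i
  = \sum_(u in block (k * K) K s) \sum_(i in block n l u) F i.
Proof.
move=> K0 sk.
(* [inord] needs an index type of successor form, which [k.+1 * K.+1] is by computation. *)
case: k sk => // k sk; case: K K0 => // K _.
rewrite (partition_big (fun i : 'I_n => inord (i %/ l) : 'I_(k.+1 * K.+1))
           (mem (block _ K.+1 s))) /=; last first.
  move=> i; rewrite !inE divnMA => /eqP is_.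
  rewrite inordK ?is_ //; rewrite -[X in (_ < X)%N]/(k.+1 * K.+1)%N.
  by rewrite -ltn_divLR // is_.
apply: eq_bigr => u; rewrite inE => /eqP us; apply: eq_bigl => i.
rewrite !inE divnMA; apply/andP/eqP => [[/eqP is_ /eqP <-]|iu].
  rewrite inordK // -[X in (_ < X)%N]/(k.+1 * K.+1)%N.
  by rewrite -ltn_divLR // is_.
by rewrite iu us eqxx; split=> //; apply/eqP/val_inj; rewrite /= inordK.
Qed.

(** * Densities as sums, and a defect form of Cauchy-Schwarz *)

Section Density.
Variables (R : realType) (n : nat) (sigma : {perm 'I_n}).
Local Notation d := (density R sigma).

Lemma pcountE (S T : {set 'I_n}) :
  (pcount sigma S T)%:R
  = \sum_(x in S) \sum_(y in T) (sigma x < y)%N%:R :> R.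
Proof.
rewrite /pcount -sum1_card natr_sum pair_big_dep /= big_mkcond /=.
rewrite [RHS]big_mkcond /=; apply: eq_bigr => -[x y] _ /=.
by rewrite !inE /=; case: (x \in S); case: (y \in T); case: ltnP.
Qed.

Lemma density_ge0 (S T : {set 'I_n}) : 0 <= d S T.
Proof. by rewrite divr_ge0 // mulr_ge0. Qed.

Lemma density_le1 (S T : {set 'I_n}) : d S T <= 1.
Proof.
rewrite /density -natrM; have [->|] := eqVneq (#|S| * #|T|)%N 0%N.
  by rewrite invr0 mulr0 ler01.
rewrite -lt0n => ST0; rewrite ler_pdivrMr ?ltr0n // mul1r ler_nat -cardsX.
by apply/subset_leq_card/subsetP => st; rewrite inE => /andP[].
Qed.

(** Written as a sum over points, the deviation of a density from a fixed [c] becomes additive over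
    cells. With [c = 0] it is a plain count. *)
Lemma sum_discrepancy (S T : {set 'I_n}) (c : R) : S != set0 -> T != set0 ->
  \sum_(x in S) \sum_(y in T) ((sigma x < y)%N%:R - c)
  = #|S|%:R * #|T|%:R * (d S T - c).
Proof.
rewrite -!card_gt0 => S0 T0.
transitivity ((pcount sigma S T)%:R - #|S|%:R * #|T|%:R * c); last first.
  by rewrite mulrBr /density mulrCA mulfV ?mulr1 // mulf_neq0 ?pnatr_eq0 -?lt0n.
rewrite pcountE; under eq_bigr do rewrite sumrB.
rewrite sumrB; congr (_ - _).
by rewrite !sumr_const -mulrnA -[LHS]mulr_natl mulnC natrM.
Qed.

End Density.

(* Expanding (|x i| - delta)^2 >= 0 replaces Cauchy-Schwarz. *)
Lemma sum_sqr_defect (R : realType) (I : finType) (A : {set I}) (x : I -> R)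
    (c delta : R) : 0 <= delta ->
  \sum_(i in A) x i = #|A|%:R * c ->
  delta * #|A|%:R <= \sum_(i in A) `|x i - c| ->
  #|A|%:R * (c ^+ 2 + delta ^+ 2) <= \sum_(i in A) x i ^+ 2.
Proof.
move=> delta0 sumx dev.
have pt i : 2 * c * x i - c ^+ 2 + (2 * delta * `|x i - c| - delta ^+ 2)
    <= x i ^+ 2.
  have : 0 <= (`|x i - c| - delta) ^+ 2 by exact: sqr_ge0.
  by rewrite sqrrB real_normK ?num_real // sqrrB; lra.
apply: le_trans (ler_sum _ (fun i _ => pt i)).
rewrite big_split /= !sumrB !sumr_const -!mulr_sumr sumx -[c ^+ 2 *+ _]mulr_natl
  -[delta ^+ 2 *+ _]mulr_natl.
have := ler_wpM2l delta0 dev.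
move: (\sum_(i in A) `|x i - c|) (#|A|%:R) => y z; lra.
Qed.

(** * Approximating rectangles by unions of cells *)

(** An interval cuts only cells that contain an endpoint: elements of any other cell compare with an
    endpoint [c] as [u] does with [c %/ l]. *)
Lemma block_interval_const (n l a b u : nat) :
  u != (a %/ l)%N -> u != (b %/ l)%N ->
  exists inside : bool, {in block n l u, forall x : 'I_n, (a <= x < b)%N = inside}.
Proof.
have cmp c (x : 'I_n) : u != (c %/ l)%N -> x \in block n l u ->
    (x < c)%N = (u < c %/ l)%N.
  rewrite inE => uc /eqP xu; case: (ltnP x c) => [xc|cx].
    by rewrite ltn_neqAle uc -xu leq_div2r // ltnW.
  by rewrite ltnNge -xu leq_div2r.
move=> ua ub; exists (~~ (u < a %/ l) && (u < b %/ l))%N => x xu.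
by rewrite leqNgt !cmp.
Qed.

(** Only an inequality, since [p], the cell index of an endpoint, may lie outside [U]. *)
Lemma sum_eq_ord_le1 (R : numDomainType) (n p : nat) (U : {set 'I_n}) :
  \sum_(u in U) (u == p :> nat)%:R <= 1 :> R.
Proof.
case: (pickP [pred u in U | u == p :> nat]) => [u /andP[/= uU /eqP up]|no].
  rewrite (bigD1 u) //= up eqxx big1 ?addr0 // => v /andP[_].
  by rewrite -val_eqE /= up => /negbTE ->.
by rewrite big1 ?ler01 // => u uU; have:= no u; rewrite /= uU /= => ->.
Qed.

(** Each of the four endpoints of [I] and [J] spoils at most one row or column of [K] cells, and a
    spoiled cell costs at most [l ^ 2]. *)
Lemma rectangle_sum_le (R : realDomainType) (n k l K s t : nat)
    (I J : {set 'I_n}) (g : 'I_n -> 'I_n -> R) :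
  (0 < l)%N -> (0 < K)%N -> (s < k)%N -> (t < k)%N -> (k * K * l <= n)%N ->
  is_interval I -> is_interval J ->
  I \subset block n (l * K) s -> J \subset block n (l * K) t ->
  (forall x y, `|g x y| <= 1) ->
  `|\sum_(x in I) \sum_(y in J) g x y| <=
    \sum_(u in block (k * K) K s) \sum_(v in block (k * K) K t)
      `|\sum_(x in block n l u) \sum_(y in block n l v) g x y|
    + 4 * K%:R * l%:R ^+ 2.
Proof.
move=> l0 K0 sk tk kKl [a [b defI]] [c [e defJ]] sIs sJt g1.
(* Extending [g] by zero outside the rectangle lets the sum run over whole blocks, which split into
   cells. *)
pose h x y := (x \in I)%:R * (y \in J)%:R * g x y.
have -> : \sum_(x in I) \sum_(y in J) g x y
    = \sum_(x in block n (l * K) s) \sum_(y in block n (l * K) t) h x y.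
  rewrite [RHS](big_setID I) /= (setIidPr sIs) [X in _ + X]big1 ?addr0; last first.
    by move=> x /setDP[_ /negbTE xI]; rewrite big1 // => y _; rewrite /h xI !mul0r.
  apply: eq_bigr => x xI.
  rewrite [RHS](big_setID J) /= (setIidPr sJt) [X in _ + X]big1 ?addr0; last first.
    by move=> y /setDP[_ /negbTE yJ]; rewrite /h yJ mulr0 mul0r.
  by apply: eq_bigr => y yJ; rewrite /h xI yJ !mul1r.
(* Counts the endpoints in the cell [u], where [p] and [q] are the cell indices of the two endpoints
   of an interval. *)
pose bad p q (u : nat) : R := (u == p)%:R + (u == q)%:R.
have bad_ge0 p q u : 0 <= bad p q u by rewrite addr_ge0.
have cardl (u : 'I_(k * K)) : #|block n l u| = l.
  rewrite card_block // (leq_trans _ kKl) // leq_mul2r ltn_ord orbT //.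
have cell (u v : 'I_(k * K)) :
    `|\sum_(x in block n l u) \sum_(y in block n l v) h x y| <=
    `|\sum_(x in block n l u) \sum_(y in block n l v) g x y| +
    l%:R ^+ 2 * (bad (a %/ l)%N (b %/ l)%N u + bad (c %/ l)%N (e %/ l)%N v).
  (* A cell not inside a row or column band containing an endpoint of I or J is
     inside or outside I x J; any other one is estimated trivially. *)
  have trivial : 1 <= bad (a %/ l)%N (b %/ l)%N u + bad (c %/ l)%N (e %/ l)%N v ->
      `|\sum_(x in block n l u) \sum_(y in block n l v) h x y| <=
      `|\sum_(x in block n l u) \sum_(y in block n l v) g x y| +
      l%:R ^+ 2 * (bad (a %/ l)%N (b %/ l)%N u + bad (c %/ l)%N (e %/ l)%N v).
    move=> bad1; apply: le_trans (_ : l%:R ^+ 2 <= _); last first.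
      by rewrite -[X in X <= _]add0r lerD // ler_peMr // exprn_ge0.
    apply: le_trans (ler_norm_sum _ _ _) _.
    apply: le_trans (_ : \sum_(x in block n l u) l%:R <= _); last first.
      by rewrite sumr_const cardl -[l%:R *+ l]mulr_natl expr2.
    apply: ler_sum => x _; apply: le_trans (ler_norm_sum _ _ _) _.
    rewrite -[X in _ <= X%:R](cardl v) -sumr_const; apply: ler_sum => y _.
    rewrite /h !normrM !normr_nat -natrM mulnb.
    by case: (_ && _); rewrite ?mul1r ?mul0r.
  have [ua|ua] := eqVneq (u : nat) (a %/ l)%N.
    by apply: trivial; rewrite /bad ua eqxx -!addrA lerDl !addr_ge0.
  have [ub|ub] := eqVneq (u : nat) (b %/ l)%N.
    by apply: trivial; rewrite /bad ub eqxx addrAC lerDr !addr_ge0.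
  have [vc|vc] := eqVneq (v : nat) (c %/ l)%N.
    by apply: trivial; rewrite /bad vc eqxx addrCA lerDl !addr_ge0.
  have [ve|ve] := eqVneq (v : nat) (e %/ l)%N.
    by apply: trivial; rewrite /bad ve eqxx addrA lerDr !addr_ge0.
  have [i Iu] := block_interval_const n ua ub.
  have [j Jv] := block_interval_const n vc ve.
  have -> : \sum_(x in block n l u) \sum_(y in block n l v) h x y =
      (i && j)%:R * \sum_(x in block n l u) \sum_(y in block n l v) g x y.
    rewrite mulr_sumr; apply: eq_bigr => x xu; rewrite mulr_sumr.
    by apply: eq_bigr => y yv; rewrite /h defI defJ !inE Iu // Jv // -natrM mulnb.
  apply: le_trans (_ : `|\sum_(x in block n l u) \sum_(y in block n l v) g x y| <= _).
    by case: (i && j); rewrite ?mul1r // mul0r normr0.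
  by rewrite lerDl mulr_ge0 ?exprn_ge0 // addr_ge0.
rewrite (sum_subblocks _ _ K0 sk).
have -> : \sum_(u in block (k * K) K s) \sum_(x in block n l u)
      \sum_(y in block n (l * K) t) h x y =
    \sum_(u in block (k * K) K s) \sum_(v in block (k * K) K t)
      \sum_(x in block n l u) \sum_(y in block n l v) h x y.
  apply: eq_bigr => u _; rewrite [RHS]exchange_big /=.
  by apply: eq_bigr => x _; rewrite (sum_subblocks _ _ K0 tk).
apply: le_trans (ler_norm_sum _ _ _) _.
apply: le_trans (ler_sum _ (fun u _ => ler_norm_sum _ _ _)) _.
apply: le_trans (ler_sum _ (fun u _ => ler_sum _ (fun v _ => cell u v))) _.
under eq_bigr do rewrite big_split /=.
rewrite big_split /= lerD2l.
under eq_bigr do rewrite -mulr_sumr.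
rewrite -mulr_sumr mulrC ler_wpM2r ?exprn_ge0 //.
under eq_bigr do rewrite big_split /= sumr_const.
rewrite big_split /= sumr_const sumrMnl.
rewrite !card_block ?leq_mul2r ?sk ?tk ?orbT // -mulrnDl mulr_natr.
have bad2 (U : {set 'I_(k * K)}) p q : \sum_(u in U) bad p q u <= 2.
  by rewrite big_split /= (_ : 2 = 1 + 1) // lerD // sum_eq_ord_le1.
rewrite lerMn2r; apply/orP; right.
by apply: le_trans (lerD (bad2 _ _ _) (bad2 _ _ _)) _; rewrite -natrD.
Qed.

(** * Energy under refinement *)

Section Energy.
Variables (R : realType) (n : nat) (sigma : {perm 'I_n}).
Local Notation d := (density R sigma).

Definition energy (w k : nat) : R :=
  \sum_(s < k) \sum_(t < k) d (block n w s) (block n w t) ^+ 2 / k%:R ^+ 2.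

Lemma energy_ge0 (w k : nat) : 0 <= energy w k.
Proof.
by do 2!(apply: sumr_ge0 => ? _); rewrite divr_ge0 ?exprn_ge0 ?density_ge0.
Qed.

Lemma energy_le1 (w k : nat) : (0 < k)%N -> energy w k <= 1.
Proof.
move=> k0; apply: le_trans (_ : \sum_(s < k) \sum_(t < k) (k%:R ^+ 2)^-1 <= _).
  do 2!(apply: ler_sum => ? _); rewrite ler_piMl ?invr_ge0 ?exprn_ge0 //.
  by rewrite exprn_ile1 ?density_ge0 ?density_le1.
rewrite !sumr_const !card_ord -mulrnA -[X in X <= _]mulr_natr natrM -expr2.
by rewrite mulVf // expf_neq0 // pnatr_eq0 -lt0n.
Qed.

Variables (k l K : nat).
Hypotheses (l0 : (0 < l)%N) (K0 : (0 < K)%N) (kKl : (k * K * l <= n)%N).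
Variables s t : nat.
Hypotheses (sk : (s < k)%N) (tk : (t < k)%N).

Let card_big (u : nat) : (u < k)%N -> #|block n (l * K) u| = (l * K)%N.
Proof.
move=> uk; rewrite card_block ?muln_gt0 ?l0 // (leq_trans _ kKl) //.
by rewrite -mulnA [(K * l)%N]mulnC leq_mul2r uk orbT.
Qed.

Let card_small (u : 'I_(k * K)) : #|block n l u| = l.
Proof. by rewrite card_block // (leq_trans _ kKl) // leq_mul2r ltn_ord orbT. Qed.

Let block_neq0 (w u : nat) : (0 < #|block n w u|)%N -> block n w u != set0.
Proof. by rewrite card_gt0. Qed.

Let sum_discrepancy_small (c : R) (u v : 'I_(k * K)) :
  \sum_(x in block n l u) \sum_(y in block n l v) ((sigma x < y)%N%:R - c)
  = l%:R ^+ 2 * (d (block n l u) (block n l v) - c).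
Proof.
by rewrite sum_discrepancy ?block_neq0 ?card_small // expr2.
Qed.

(** Pair counts add up over cells, and all cells have the same size, so the density of a pair of
    blocks is the mean over its [K ^ 2] pairs of cells. *)
Lemma sum_density_subblocks :
  \sum_(u in block (k * K) K s) \sum_(v in block (k * K) K t)
     d (block n l u) (block n l v)
  = K%:R ^+ 2 * d (block n (l * K) s) (block n (l * K) t).
Proof.
have lR : l%:R ^+ 2 != 0 :> R by rewrite expf_neq0 // pnatr_eq0 -lt0n.
apply: (mulfI lR).
transitivity (\sum_(x in block n (l * K) s) \sum_(y in block n (l * K) t)
   ((sigma x < y)%N%:R - 0 : R)); last first.
  rewrite sum_discrepancy ?block_neq0 ?card_big ?muln_gt0 ?l0 //.
  by rewrite !natrM; ring.
rewrite (sum_subblocks _ _ K0 sk) mulr_sumr; apply: eq_bigr => u _.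
under [RHS]eq_bigr do rewrite (sum_subblocks _ _ K0 tk).
rewrite exchange_big /= mulr_sumr; apply: eq_bigr => v _.
by rewrite sum_discrepancy_small subr0.
Qed.

(** Witnesses [I], [J] of irregularity have discrepancy at least [eps ^ 3 * (l * K) ^ 2]; by
    [rectangle_sum_le] the cells account for all of it but [4 * K * l ^ 2]. *)
Lemma irregular_deviation (eps : R) : 0 < eps -> 8 <= eps ^+ 3 * K%:R ->
  ~ regular_pair sigma eps (block n (l * K) s) (block n (l * K) t) ->
  eps ^+ 3 / 2 * K%:R ^+ 2 <=
  \sum_(u in block (k * K) K s) \sum_(v in block (k * K) K t)
    `|d (block n l u) (block n l v) - d (block n (l * K) s) (block n (l * K) t)|.
Proof.
move=> eps0 hK irr; set c := d (block n (l * K) s) _.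
have [I [J [iI iJ sI sJ [bI bJ dev]]]] : exists I J : {set 'I_n},
    [/\ is_interval I, is_interval J, I \subset block n (l * K) s,
        J \subset block n (l * K) t &
     [/\ eps * (l * K)%:R <= #|I|%:R, eps * (l * K)%:R <= #|J|%:R &
      eps < `|d I J - c|]].
  apply: contrapT => no; apply: irr => I J iI iJ sI sJ.
  rewrite !card_big // => bI bJ; rewrite leNgt; apply/negP => dev.
  by apply: no; exists I, J.
have lK0 : 0 < (l * K)%:R :> R by rewrite ltr0n muln_gt0 l0.
have pos (A : {set 'I_n}) : eps * (l * K)%:R <= #|A|%:R :> R -> A != set0.
  by rewrite -card_gt0 -(ltr0n R); apply: lt_le_trans; rewrite mulr_gt0.
have g1 x y : `|(sigma x < y)%N%:R - c| <= 1.
  have := density_ge0 R sigma (block n (l * K) s) (block n (l * K) t).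
  have := density_le1 R sigma (block n (l * K) s) (block n (l * K) t).
  by rewrite -/c ler_norml; case: (_ < _)%N => /=; lra.
have := rectangle_sum_le l0 K0 sk tk kKl iI iJ sI sJ g1.
rewrite sum_discrepancy ?pos //.
under eq_bigr do under eq_bigr do
  rewrite sum_discrepancy_small normrM (ger0_norm (exprn_ge0 _ (ler0n _ _))).
under eq_bigr do rewrite -mulr_sumr.
rewrite -mulr_sumr normrM ger0_norm ?mulr_ge0 //.
set S := \sum_(u in _) _ => le_S.
have low : eps ^+ 3 * (l * K)%:R ^+ 2 <= #|I|%:R * #|J|%:R * `|d I J - c|.
  have -> : eps ^+ 3 * (l * K)%:R ^+ 2 =
     (eps * (l * K)%:R) * (eps * (l * K)%:R) * eps :> R by ring.
  by rewrite ler_pM ?mulr_ge0 ?(ltW eps0) ?(ltW dev) // ler_pM // mulr_ge0 ?ltW.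
have lR : 0 < l%:R ^+ 2 :> R by rewrite exprn_gt0 // ltr0n.
rewrite -(ler_pM2l lR).
have KR : 0 < K%:R :> R by rewrite ltr0n.
(* As [8 <= eps ^ 3 * K], the boundary loss is at most half of [eps ^ 3 * (l * K) ^ 2]. *)
have : 0 <= (eps ^+ 3 * K%:R - 8) * (K%:R * l%:R ^+ 2).
  by rewrite mulr_ge0 ?subr_ge0 // mulr_ge0 ?ltW.
have := le_trans low le_S; rewrite natrM exprMn.
move: (l%:R ^+ 2) (K%:R : R) (eps ^+ 3) => x y z; lra.
Qed.

(** This is [sum_sqr_defect] for the densities of the pairs of cells, with [delta = eps ^ 3 / 2] for
    an irregular pair and [delta = 0] for a regular one. The indicator is the membership test of
    [irregular_pairs], so that it sums to the cardinal. *)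
Lemma subblock_energy (eps : R) : 0 < eps -> 8 <= eps ^+ 3 * K%:R ->
  d (block n (l * K) s) (block n (l * K) t) ^+ 2
  + (~~ `[< regular_pair sigma eps (block n (l * K) s) (block n (l * K) t) >])%:R
      * (eps ^+ 3 / 2) ^+ 2
  <= (\sum_(u in block (k * K) K s) \sum_(v in block (k * K) K t)
     d (block n l u) (block n l v) ^+ 2) / K%:R ^+ 2.
Proof.
move=> eps0 hK; have K2 : 0 < K%:R ^+ 2 :> R by rewrite exprn_gt0 // ltr0n.
rewrite ler_pdivlMr // [_ * K%:R ^+ 2]mulrC.
pose P := setX (block (k * K) K s) (block (k * K) K t).
pose x uv := d (block n l (uv : 'I_(k * K) * 'I_(k * K)).1) (block n l uv.2).
have cardP : #|P|%:R = K%:R ^+ 2 :> R.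
  by rewrite cardsX !card_block ?leq_mul2r ?sk ?tk ?orbT // natrM expr2.
have toP (F : 'I_(k * K) -> 'I_(k * K) -> R) :
    \sum_(u in block (k * K) K s) \sum_(v in block (k * K) K t) F u v
    = \sum_(uv in P) F uv.1 uv.2.
  by rewrite pair_big /=; apply: eq_bigl => -[u v]; rewrite in_setX.
have avg := sum_density_subblocks; rewrite toP -cardP in avg.
rewrite toP -cardP; case: asboolP => /= [_|irr].
  have := sum_sqr_defect (x := x) (lexx 0) avg; rewrite expr0n !mul0r.
  by apply; rewrite sumr_ge0.
have dev := irregular_deviation eps0 hK irr; rewrite toP -cardP in dev.
rewrite mul1r; apply: (sum_sqr_defect (x := x) _ avg dev).
by rewrite divr_ge0 // exprn_ge0 // ltW.
Qed.
End Energy.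

(** * Blocks as a partition with an exceptional set *)

(** For positive [w] the exceptional set is the tail of elements from [k * w] on. *)
Definition block_partition (n w k : nat) (j : 'I_k.+1) : {set 'I_n} :=
  if unlift ord0 j is Some s then block n w s else [set i : 'I_n | k <= i %/ w]%N.

Lemma block_partition_lift (n w k : nat) (s : 'I_k) :
  block_partition n w (lift ord0 s) = block n w s.
Proof. by rewrite /block_partition liftK. Qed.

Lemma block_partition0 (n w k : nat) :
  block_partition n w (@ord0 k) = [set i : 'I_n | k <= i %/ w]%N.
Proof. by rewrite /block_partition unlift_none. Qed.

Lemma card_block_lt (n w k s : nat) :
  (0 < w)%N -> (k * w <= n)%N -> (s < k)%N -> #|block n w s| = w.
Proof.
by move=> w0 kw sk; rewrite card_block // (leq_trans _ kw) // leq_mul2r sk orbT.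
Qed.

Lemma card_block_partition0 (n w k : nat) : (0 < w)%N -> (0 < k)%N ->
  (k * w <= n)%N -> #|block_partition n w (@ord0 k)| = (n - k * w)%N.
Proof.
move=> w0 k0 kw; rewrite block_partition0.
have -> : [set i : 'I_n | k <= i %/ w]%N = ~: block n (w * k) 0.
  by apply/setP => i; rewrite !inE divnMA -leqn0 -ltnNge divn_gt0.
by rewrite cardsCs setCK card_ord [(k * w)%N]mulnC card_block ?mul1n ?muln_gt0 ?w0 // mulnC.
Qed.

Lemma block_partitionP (n w k : nat) : (0 < w)%N -> (k * w <= n)%N ->
  is_interval_partition (@block_partition n w k).
Proof.
move=> w0 kw; split.
- apply/setP => i; rewrite inE; apply/bigcupP.
  have [ik|ki] := ltnP (i %/ w) k.
    by exists (lift ord0 (Ordinal ik)); rewrite // block_partition_lift inE.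
  by exists ord0; rewrite // block_partition0 inE.
(* An element determines the index of its part, so parts sharing an element coincide. *)
- have part_val (i : 'I_k.+1) (x : 'I_n) : x \in block_partition n w i ->
      i = inord (if x %/ w < k then (x %/ w).+1 else 0)%N.
    case: (unliftP ord0 i) => [s|] ->.
      rewrite block_partition_lift inE => /eqP ->; rewrite ltn_ord.
      by apply: val_inj; rewrite /= inordK ?ltnS.
    rewrite block_partition0 inE leqNgt => /negbTE ->.
    by apply: val_inj; rewrite /= inordK.
  move=> i j; apply: contraR => /pred0Pn[x /andP[/= xi xj]].
  by rewrite (part_val _ _ xi) (part_val _ _ xj).
- move=> s; rewrite block_partition_lift; split; last exact: block_interval.
  by rewrite -card_gt0 (card_block_lt w0 kw).
Qed.

(** * Energy increment and iteration *)

(** Averages [subblock_energy] over all pairs of blocks. *)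
Lemma energy_increment (R : realType) (n : nat) (sigma : {perm 'I_n}) (eps : R)
    (k l K : nat) :
  (0 < k)%N -> (0 < l)%N -> (0 < K)%N -> (k * K * l <= n)%N ->
  0 < eps -> 8 <= eps ^+ 3 * K%:R ->
  energy R sigma (l * K) k
  + #|irregular_pairs sigma eps (@block_partition n (l * K) k)|%:R / k%:R ^+ 2
    * (eps ^+ 3 / 2) ^+ 2
  <= energy R sigma l (k * K).
Proof.
move=> k0 l0 K0 kKl eps0 hK.
(* Pairs of cells are grouped by the pair of big blocks containing them. *)
have -> : energy R sigma l (k * K) =
    \sum_(s < k) \sum_(t < k)
      (\sum_(u in block (k * K) K s) \sum_(v in block (k * K) K t)
        density R sigma (block n l u) (block n l v) ^+ 2) / K%:R ^+ 2 / k%:R ^+ 2.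
  rewrite /energy sum_blocks //; apply: eq_bigr => s _.
  under eq_bigr do rewrite sum_blocks //.
  rewrite exchange_big /=; apply: eq_bigr => t _.
  rewrite -mulrA -invfM -exprMn -natrM [(K * k)%N]mulnC mulr_suml.
  by apply: eq_bigr => u _; rewrite mulr_suml.
have kinv : 0 <= (k%:R ^+ 2)^-1 :> R by rewrite invr_ge0 exprn_ge0.
have step (s t : 'I_k) := ler_wpM2r kinv
  (subblock_energy sigma l0 K0 kKl (ltn_ord s) (ltn_ord t) eps0 hK).
apply: le_trans (ler_sum _ (fun s _ => ler_sum _ (fun t _ => step s t))).
rewrite /energy; under [X in _ <= X]eq_bigr do under eq_bigr do rewrite mulrDl.
under [X in _ <= X]eq_bigr do rewrite big_split /=.
rewrite big_split /= lerD2l.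
rewrite -sum1_card natr_sum mulr_suml mulr_suml pair_big big_mkcond /=.
apply: ler_sum => -[s t] _; rewrite inE /= !block_partition_lift.
by case: (~~ _); rewrite ?mul0r // mulrAC.
Qed.

Theorem theorem1 (R : realType) (m : nat) (eps : R) (hm : (0 < m)%N)
    (heps : 0 < eps) :
  exists M N : nat,
    forall n : nat, (N <= n)%N ->
    forall sigma : {perm 'I_n},
    exists k : nat, (m <= k <= M)%N /\
      exists C : 'I_k.+1 -> {set 'I_n}, regular_partition sigma eps C.
Proof.
have bound (x y : R) : 0 < x -> 0 <= y -> exists2 j : nat, (0 < j)%N & y <= x * j%:R.
  move=> x0 y0; exists (Num.bound (y / x)).+1 => //.
  rewrite mulrC -ler_pdivrMr //; apply: ltW.
  by apply: lt_trans (archi_boundP _) _; rewrite ?divr_ge0 ?(ltW x0) // ltr_nat.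
pose gain := eps * (eps ^+ 3 / 2) ^+ 2.
have gain0 : 0 < gain by rewrite mulr_gt0 // exprn_gt0 // divr_gt0 // exprn_gt0.
have [K K0 hK] := bound (eps ^+ 3) 8 (exprn_gt0 _ heps) (ler0n _ _).
(* After [r] gains the energy would be at least 2, above its bound 1. *)
have [r _ hr] := bound gain 2 gain0 (ler0n _ _).
pose M := (m * K ^ r)%N.
have M0 : (0 < M)%N by rewrite muln_gt0 hm expn_gt0 K0.
have [N _ hN] := bound eps M%:R heps (ler0n _ _).
(* [M <= n] makes the blocks nonempty; [N <= n] gives [M <= eps * n], which bounds the fewer than
   [M] leftover elements. *)
exists M, (M + N)%N => n MNn sigma.
have Mn : (M <= n)%N := leq_trans (leq_addr _ _) MNn.
pose L := (n %/ M)%N.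
have L0 : (0 < L)%N by rewrite divn_gt0.
(* The finest blocks, at [i = r], have width [L]. For [i <= r] the product [k i * w i] is always
   [L * M], so the exceptional set never changes. *)
pose w i := (L * K ^ (r - i))%N; pose k i := (m * K ^ i)%N.
have w0 i : (0 < w i)%N by rewrite muln_gt0 L0 expn_gt0 K0.
have k0 i : (0 < k i)%N by rewrite muln_gt0 hm expn_gt0 K0.
have kw i : (i <= r)%N -> (k i * w i = L * M)%N.
  by move=> ir; rewrite /k /w mulnCA -mulnA -expnD subnKC.
have LMn : (L * M <= n)%N := leq_trunc_div n M.
pose few i := #|irregular_pairs sigma eps (@block_partition n (w i) (k i))|%:R
  <= eps * (k i)%:R ^+ 2.
have [[i ir few_i]|none] := pselect (exists2 i, (i <= r)%N & few i).
  have kwn : (k i * w i <= n)%N by rewrite kw.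
  exists (k i); split.
    rewrite leq_pmulr ?expn_gt0 ?K0 //=.
    by rewrite leq_mul2l leq_pexp2l ?orbT.
  exists (@block_partition n (w i) (k i)); split => //.
  - exact: block_partitionP.
  - by move=> s t; rewrite !block_partition_lift !(card_block_lt (w0 i) kwn).
  - rewrite card_block_partition0 // kw //.
    apply: le_trans (_ : M%:R <= _).
      by rewrite ler_nat /L leq_subLR {1}(divn_eq n M) leq_add2l ltnW ?ltn_pmod.
    apply: le_trans hN _; rewrite ler_pM2l // ler_nat.
    exact: leq_trans (leq_addl _ _) MNn.
(* By [none], every stage up to [r] has more than [eps * k ^ 2] irregular pairs, so each refinement
   adds at least [gain]. *)
have grow i : (i <= r)%N -> gain * i%:R <= energy R sigma (w i) (k i).
  elim: i => [|i IH] ir; first by rewrite mulr0 energy_ge0.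
  have ki : k i.+1 = (k i * K)%N by rewrite /k expnSr mulnA.
  have wi : w i = (w i.+1 * K)%N by rewrite /w -mulnA -expnSr subnSK.
  have many : eps * (k i)%:R ^+ 2 <
      #|irregular_pairs sigma eps (@block_partition n (w i) (k i))|%:R.
    by rewrite ltNge; apply/negP => few_i; apply: none; exists i => //; apply: ltnW.
  have := energy_increment sigma (k0 i) (w0 i.+1) K0 _ heps hK.
  rewrite -ki -wi kw // => /(_ LMn); apply: le_trans.
  rewrite -natr1 mulrDr mulr1 lerD ?IH 1?ltnW //.
  rewrite ler_wpM2r ?sqr_ge0 // ler_pdivlMr ?ltW //.
  by rewrite exprn_gt0 // ltr0n.
have := le_trans (grow r (leqnn r)) (energy_le1 R sigma (w r) (k0 r)).
by move=> /(le_trans hr); rewrite (ler_nat _ 2 1).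
Qed.
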